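(* For any integer $\ell\ge 1$, let $G_\ell$ denote the number of camouflaging vertices in the uniform random recursive tree process run up to time $2\ell$. Then $$\mathbb{E}\,G_\ell\ge \frac{\ell}{384},$$ and for any $t\ge 0$, $$\mathbb{P}\left\{G_\ell\le \frac{\ell}{384}-t\right\}\le e^{-t^2/(2\ell)} .$$
   Context: Uniform random recursive tree: $T_1$ is the single vertex $1$ (the root); for $i\ge 2$, $T_i$ is obtained from $T_{i-1}$ by joining vertex $i$ by an edge to a vertex of $T_{i-1}$ (its parent) chosen uniformly at random from $\{1,\ldots,i-1\}$, independently of all previous choices. A leaf of $T_i$ is a vertex with no children in $T_i$. Singleton: a vertex of $T_\ell$ is called a singleton if it is a leaf of $T_\ell$ and it is the only descendant of its parent vertex in $T_\ell$. Camouflaging vertex: a vertex $v$ of $T_\ell$ is called camouflaging if (1) in $T_\ell$, $v$ is the parent of a singleton $d$; (2) between times $\ell+1$ and $2\ell$ a vertex $w$ is attached to $v$ such that $w$ is a leaf of $T_{2\ell}$; (3) $d$ is a leaf of $T_{2\ell}$. The random variable $G_\ell$ is the number of camouflaging vertices.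
   Formalization: The theorem is proved for ℓ ≥ 2 instead of ℓ ≥ 1: at ℓ = 1 the tree T_1 is the root alone, so there is no singleton and G_1 = 0, and both the mean bound and the tail bound (for 0 < t ≤ 1/384) fail. *)

(* Defs.v *)
(* MathComp-Analysis *)
From HB Require Import structures.
From mathcomp Require Import all_boot all_order all_algebra finmap.
From mathcomp Require Import all_classical all_reals all_analysis.

Set Implicit Arguments.
Unset Strict Implicit.
Unset Printing Implicit Defensive.

Import Order.TTheory GRing.Theory Num.Theory.

Local Open Scope classical_set_scope.
Local Open Scope ring_scope.

(* A recursive tree is given by its parent function p : nat -> nat.  The tree
   T_n has vertex set {1, .., n} and an edge between i and p i for every
   2 <= i <= n; the values p 0 and p 1 are never used. *)

Definition child (p : nat -> nat) (n u v : nat) : bool :=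
  (2 <= v <= n)%N && (p v == u).

Definition leaf (p : nat -> nat) (n v : nat) : Prop :=
  (1 <= v <= n)%N /\ forall c : nat, ~~ child p n v c.

(* Descendants are proper: w lies at the end of a nonempty chain of children
   starting at u. *)
Definition descendant (p : nat -> nat) (n u w : nat) : Prop :=
  exists s : seq nat, path (child p n) u (rcons s w).

(* The root has no parent, hence 2 <= d. *)
Definition singleton (p : nat -> nat) (n d : nat) : Prop :=
  [/\ (2 <= d <= n)%N, leaf p n d &
      forall w : nat, descendant p n (p d) w <-> w = d].

Definition camouflaging (p : nat -> nat) (l v : nat) : Prop :=
  exists d w : nat,
    [/\ child p l v d /\ singleton p l d,
        (l.+1 <= w <= l.*2)%N /\ child p l.*2 v w,
        leaf p l.*2 w & leaf p l.*2 d].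

(* G_l *)
Definition camouflaging_count (p : nat -> nat) (l : nat) : nat :=
  (\sum_(1 <= v < l.+1) `[< camouflaging p l v >])%N.

(* G_1 = 0 on every tree, so the bound E G_l >= l / 384 needs l >= 2. *)
Lemma camouflaging_count1 (p : nat -> nat) : camouflaging_count p 1 = 0%N.
Proof.
rewrite /camouflaging_count big_nat1; case: asboolP => // -[d [w [[]]]].
by rewrite /child => /andP[/andP[d2 d1]]; have := leq_trans d2 d1.
Qed.

(* The product rule for every finite subfamily of (X i), i in D. *)
Definition mutually_independent d d' (T : measurableType d)
    (T' : measurableType d') (R : realType) (P : probability T R)
    (I : choiceType) (D : set I) (X : I -> {RV P >-> T'}) : Prop :=
  forall (J : {fset I}) (A : I -> set T'),
    [set` J] `<=` D -> (forall i, measurable (A i)) ->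
    P (\bigcap_(i in [set` J]) (X i @^-1` A i)) =
    (\prod_(i <- J) P (X i @^-1` A i))%E.

(* The random recursive tree process up to time n: the parents of 2, .., n are
   independent, the parent of i being uniform on {1, .., i - 1}. *)
Definition uniform_random_recursive_tree d (T : measurableType d)
    (R : realType) (P : probability T R) (n : nat)
    (parent : nat -> {RV P >-> nat}) : Prop :=
  mutually_independent [set i | (2 <= i <= n)%N] parent /\
  forall i j : nat, (2 <= i <= n)%N -> (1 <= j <= i.-1)%N ->
    P (parent i @^-1` [set j]) = ((i.-1)%:R^-1 : R)%:E.

(* Main.v *)
Require Import Defs.
From HB Require Import structures.
From mathcomp Require Import all_boot all_order all_algebra finmap.
From mathcomp Require Import all_classical all_reals all_analysis.
From mathcomp Require Import measurable_realfun zify ring lra.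

(* A camouflaging vertex is counted through its singleton child.  Attaching a
   vertex to the tree T_n changes the numbers L of leaves and S of singletons
   (n < l), and then the numbers C of singletons of T_l that are still leaves
   and B of those whose parent is camouflaging (n >= l), by at most 1, and
     E S_{n+1} = (1 - 2/n) S_n + L_n / n,   E L_{n+1} = (1 - 1/n) L_n + 1,
     E C_{n+1} = (1 - 1/n) C_n,   E B_{n+1} >= (1 - 3/n) B_n + C_n / n
   conditionally on T_n.  Hence, for nonnegative a, b with a + b <= 1, the
   conditional mean of exp (- x (a S_{n+1} + b L_{n+1})) is at most exp (2 x^2)
   times a term of the same form at time n, with new coefficients read off the
   recurrences, and likewise for B and C.  Going down to T_2 gives
     E exp (- x B_{2l}) <= exp (4 x^2 l - x l / 60)   for 0 <= x <= 1/2.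
   As 1/60 exceeds 1/384 by far, this crude bound implies both claims: the tail
   bound by Markov's inequality at x = t / l, and the bound on the mean by
   Jensen's inequality at x = 1 / (480 l). *)

Set Implicit Arguments.
Unset Strict Implicit.
Unset Printing Implicit Defensive.

Import Order.TTheory GRing.Theory Num.Theory.

Local Open Scope classical_set_scope.
Local Open Scope ring_scope.

(** * Growing a recursive tree by one vertex *)

Definition recursive (n : nat) (p : nat -> nat) : Prop :=
  forall i, (2 <= i <= n)%N -> (1 <= p i < i)%N.

Definition attach (p : nat -> nat) (i u : nat) : nat -> nat :=
  fun j => if j == i then u else p j.

Definition leafb (p : nat -> nat) (n v : nat) : bool :=
  ~~ has (fun c => p c == v) (index_iota 2 n.+1).

(* [lone p n d] for 2 <= d <= n: d is a singleton of T_n. *)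
Definition lone (p : nat -> nat) (n d : nat) : bool :=
  leafb p n d && all (fun c => (p c == p d) ==> (c == d)) (index_iota 2 n.+1).

Definition candidate (p : nat -> nat) (l n d : nat) : bool :=
  lone p l d && leafb p n d.

(* [masked p l n d]: the parent of the singleton d of T_l is camouflaging at
   time n, because of the witness w selected by [masks]. *)
Definition masks (p : nat -> nat) (n d w : nat) : bool :=
  (p w == p d) && leafb p n w.

Definition masked (p : nat -> nat) (l n d : nat) : bool :=
  candidate p l n d && has (masks p n d) (index_iota l.+1 n.+1).

(** The counts L, S, C and B. The last two run over the vertices of T_l, although they are read at
    time n. *)
Definition leaves p n := (\sum_(1 <= v < n.+1) leafb p n v)%N.
Definition lones p n := (\sum_(2 <= d < n.+1) lone p n d)%N.
Definition candidates p l n := (\sum_(2 <= d < l.+1) candidate p l n d)%N.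
Definition maskeds p l n := (\sum_(2 <= d < l.+1) masked p l n d)%N.

Lemma leafbP p n v :
  reflect (forall c, (2 <= c <= n)%N -> p c != v) (leafb p n v).
Proof.
apply: (iffP hasPn) => h c; first by move=> cn; apply: h;
  rewrite mem_index_iota.
by rewrite mem_index_iota => cn; apply: h.
Qed.

Lemma loneP p n d :
  reflect (leafb p n d /\
           forall c, (2 <= c <= n)%N -> p c = p d -> c = d) (lone p n d).
Proof.
apply: (iffP andP) => -[leafd h]; split=> //.
  move=> c cn pc; have /allP/(_ c) := h.
  by rewrite mem_index_iota pc eqxx => /(_ cn)/eqP.
by apply/allP => c; rewrite mem_index_iota => cn; apply/implyP => /eqP /h ->.
Qed.

Lemma sum_nat_bool_le1 (m n : nat) (b : nat -> bool) :
  (forall i j, (m <= i < n)%N -> (m <= j < n)%N -> b i -> b j -> i = j) ->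
  (\sum_(m <= i < n) b i <= 1)%N.
Proof.
move=> inj; have [/hasP[i]|/hasPn none] := boolP (has b (index_iota m n)).
  rewrite mem_index_iota => im bi.
  rewrite (bigD1_seq i) ?mem_index_iota ?iota_uniq//= bi big_seq_cond big1// => j.
  rewrite mem_index_iota => /andP[jm /negbTE neq].
  by case: (boolP (b j)) => // bj; rewrite (inj _ _ jm im bj bi) eqxx in neq.
rewrite big_seq big1// => i /none; by case: (b i).
Qed.

Lemma sum_nat_bool_pred1 (m n i : nat) (b : bool) :
  (m <= i < n)%N -> (\sum_(m <= j < n) (b && (j == i)) = b)%N.
Proof.
move=> im; rewrite (bigD1_seq i) ?mem_index_iota ?iota_uniq//= eqxx andbT.
by rewrite big1 ?addn0// => j /negbTE ->; rewrite andbF.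
Qed.

(** The parent of a singleton has no other child, so each v is the parent of at most one singleton
    of T_l. *)
Lemma lone_sibling_le1 p l (b : nat -> bool) v :
  (forall d, (2 <= d <= l)%N -> b d -> lone p l d /\ p d = v) ->
  (\sum_(2 <= d < l.+1) b d <= 1)%N.
Proof.
move=> bP; apply: sum_nat_bool_le1 => i j il jl.
by move=> /(bP _ il)[_ pi] /(bP _ jl)[/loneP[_ +] pj]; apply; rewrite // pi pj.
Qed.

Section Step.
Variables (n u : nat) (p : nat -> nat).
Hypotheses (rp : recursive n p) (un : (1 <= u <= n)%N).
Local Notation p' := (attach p n.+1 u).

Lemma recursive_step : recursive n.+1 p'.
Proof.
move=> i /andP[i2 ile]; rewrite /attach; case: eqP => [->|ne]; first lia.
by apply: rp; lia.
Qed.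

Lemma step_old i : (i <= n)%N -> p' i = p i.
Proof. by move=> ile; rewrite /attach ltn_eqF. Qed.

Lemma step_new : p' n.+1 = u.
Proof. by rewrite /attach eqxx. Qed.

Lemma index_iota_rcons : index_iota 2 n.+2 = rcons (index_iota 2 n.+1) n.+1.
Proof.
rewrite -cats1 /index_iota !subSS subn0 subn1.
have -> : (n = n.-1 + 1)%N by lia.
by rewrite iotaD /= addn1 add2n.
Qed.

Lemma leafb_step v : leafb p' n.+1 v = leafb p n v && (u != v).
Proof.
rewrite /leafb index_iota_rcons has_rcons negb_or step_new andbC;
  congr (~~ _ && _).
apply: eq_in_has => c; rewrite mem_index_iota => cn.
by rewrite step_old//; lia.
Qed.

Lemma leafb_new : leafb p' n.+1 n.+1.
Proof.
apply/leafbP => c cn; have := recursive_step cn; lia.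
Qed.

(** A singleton d is lost when it gets a child (u = d) or a sibling (u = p d); no old vertex becomes
    a singleton. *)
Lemma lone_step d : (2 <= d <= n)%N ->
  lone p' n.+1 d = lone p n d && ~~ ((u == d) || (u == p d)).
Proof.
move=> dn; rewrite /lone leafb_step index_iota_rcons all_rcons (@step_old d);
  last lia.
have -> : (n.+1 == d) = false by lia.
rewrite step_new implybF negb_or.
rewrite (@eq_in_all _ _ (fun c => (p c == p d) ==> (c == d))); last first.
  by move=> c; rewrite mem_index_iota => cn; rewrite step_old//; lia.
by case: leafb => //=; case: all => //=; rewrite ?andbF ?andbT.
Qed.

Lemma lone_new : lone p' n.+1 n.+1 = leafb p n u.
Proof.
apply/loneP/leafbP => [[_ h] c cn|h].
  apply/eqP => pc; have := h c; rewrite (@step_old c); last lia.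
  by rewrite step_new pc => /(_ _ erefl); lia.
split=> [|c cn]; first exact: leafb_new.
rewrite step_new; have [->//|ne] := eqVneq c n.+1.
have cn' : (2 <= c <= n)%N by lia.
rewrite (@step_old c); last lia.
by move=> pc; have := h c cn'; rewrite pc eqxx.
Qed.

Lemma leaves_step : (leaves p' n.+1 + leafb p n u = leaves p n + 1)%N.
Proof.
rewrite /leaves big_nat_recr//= leafb_new addnAC; congr (_ + _)%N.
rewrite -(@sum_nat_bool_pred1 1 n.+1 u (leafb p n u))// -big_split /=.
apply: eq_bigr => v _; rewrite leafb_step eq_sym.
by have [->|] := eqVneq v u; rewrite ?andbF ?andbT ?addn0.
Qed.

Definition lone_loss := (\sum_(2 <= d < n.+1)
  (lone p n d && ((u == d) || (u == p d))))%N.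

Lemma lones_step : (lones p' n.+1 + lone_loss = lones p n + leafb p n u)%N.
Proof.
rewrite /lones big_nat_recr/=; last lia.
rewrite lone_new addnAC; congr (_ + _)%N; rewrite -big_split /=.
apply: eq_big_nat => d dn; rewrite lone_step//.
by case: (lone p n d) => //=; case: (_ || _).
Qed.

(** As singletons are leaves, u cannot be both a singleton and the parent of one; and it is the
    parent of at most one. *)
Lemma lone_loss_le1 : (lone_loss <= 1)%N.
Proof.
apply: sum_nat_bool_le1 => i j iN jN /andP[/loneP[/leafbP leafi uniqi] ui].
move=> /andP[/loneP[/leafbP leafj uniqj] uj].
case/orP: ui => /eqP ui; case/orP: uj => /eqP uj.
- by rewrite -ui -uj.
- by have := leafi j jN; rewrite -uj ui eqxx.
- by have := leafj i iN; rewrite -ui uj eqxx.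
- by apply: uniqj; rewrite // -ui.
Qed.

(** * Attachments from time l on *)

Section Late.
Variable l : nat.
Hypothesis ln : (l <= n)%N.

Lemma lone_late d : (d <= l)%N -> lone p' l d = lone p l d.
Proof.
move=> dl; rewrite /lone (@step_old d); last lia.
congr (~~ _ && _).
  by apply: eq_in_has => c; rewrite mem_index_iota => cl; rewrite step_old//;
    lia.
by apply: eq_in_all => c; rewrite mem_index_iota => cl; rewrite step_old//; lia.
Qed.

Lemma candidate_step d : (d <= l)%N ->
  candidate p' l n.+1 d = candidate p l n d && (u != d).
Proof. by move=> dl; rewrite /candidate lone_late// leafb_step andbA. Qed.

Definition candidate_loss := (\sum_(2 <= d < l.+1)
  (candidate p l n d && (u == d)))%N.

Lemma candidates_step :
  (candidates p' l n.+1 + candidate_loss = candidates p l n)%N.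
Proof.
rewrite -big_split /=; apply: eq_big_nat => d /andP[_ dl].
by rewrite candidate_step//; case: candidate => //=; case: eqP.
Qed.

Lemma candidate_loss_le1 : (candidate_loss <= 1)%N.
Proof. by apply: sum_nat_bool_le1 => i j _ _ /andP[_ /eqP <-] /andP[_ /eqP]. Qed.

(** The first witness after time l; the default 0 only occurs when there is none. *)
Definition mask d := nth 0%N (index_iota l.+1 n.+1)
  (find (masks p n d) (index_iota l.+1 n.+1)).

Lemma maskP d : masked p l n d -> (l < mask d <= n)%N /\ masks p n d (mask d).
Proof.
case/andP=> _ hasw; split; last exact: nth_find.
have : mask d \in index_iota l.+1 n.+1 by rewrite mem_nth// -has_find.
by rewrite mem_index_iota.
Qed.

Definition masked_gain := (\sum_(2 <= d < l.+1)
  (candidate p l n d && ~~ masked p l n d && (u == p d)))%N.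

Definition masked_loss := (\sum_(2 <= d < l.+1)
  (masked p l n d && ((u == d) || (u == mask d))))%N.

(** Only an inequality: when the selected witness gets a child, another late leaf below [p d] may
    keep d masked. *)
Lemma maskeds_step :
  (maskeds p l n + masked_gain <= maskeds p' l n.+1 + masked_loss)%N.
Proof.
rewrite -!big_split /= big_nat [leqRHS]big_nat.
apply: leq_sum => d /andP[d2 dl].
have dn : (2 <= d <= n)%N by lia.
have pd : p' d = p d by apply: step_old; lia.
have [md|/negbTE nmd] := boolP (masked p l n d) => /=.
  rewrite andbF addn0; case: (boolP (_ || _)); first by rewrite addn1.
  rewrite negb_or => /andP[ud uw]; rewrite addn0.
  have [wn /andP[pw leafw]] := maskP md.
  suff -> : masked p' l n.+1 d by [].
  rewrite /masked candidate_step// ud; case/andP: md => -> _ /=.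
  apply/hasP; exists (mask d); first by rewrite mem_index_iota; lia.
  by rewrite /masks leafb_step leafw uw andbT step_old ?pd//; lia.
rewrite add0n addn0 andbT.
case: (boolP (candidate p l n d && _)) => // /andP[cd /eqP upd].
suff -> : masked p' l n.+1 d by [].
rewrite /masked candidate_step// cd /=; apply/andP; split.
  by rewrite upd; have := rp dn; lia.
apply/hasP; exists n.+1; first by rewrite mem_index_iota; lia.
by rewrite /masks leafb_new andbT pd step_new upd.
Qed.

Lemma masked_gain_le1 : (masked_gain <= 1)%N.
Proof.
apply: (@lone_sibling_le1 p l _ u) => d _ /andP[/andP[/andP[-> _] _] /eqP ->].
by [].
Qed.

(** Both d and its witness are children of [p d], so whichever of them u is, d is the singleton
    child of [p u]. *)
Lemma masked_loss_le1 : (masked_loss <= 1)%N.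
Proof.
apply: (@lone_sibling_le1 p l _ (p u)) => d _ /andP[md].
have [_ /andP[/eqP pw _]] := maskP md; case/andP: md => /andP[-> _] _.
by case/orP => /eqP ->.
Qed.

End Late.
End Step.

(** * Number of attachments that cause a loss or a gain *)

Section StepSums.
Variables (n : nat) (p : nat -> nat).
Hypotheses (rp : recursive n p).

Lemma sum_lone_loss : (\sum_(1 <= u < n.+1) lone_loss n u p = (lones p n).*2)%N.
Proof.
rewrite exchange_big_nat /= -addnn -big_split /=.
apply: eq_big_nat => d dn; have pd := rp dn.
rewrite -{2}(@sum_nat_bool_pred1 1 n.+1 d (lone p n d)); last lia.
rewrite -{1}(@sum_nat_bool_pred1 1 n.+1 (p d) (lone p n d)); last lia.
rewrite -big_split /=; apply: eq_bigr => u _; case: (lone p n d) => //=.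
by have [->|] := eqVneq u d => //=; case: eqP => // e; lia.
Qed.

Variable l : nat.
Hypothesis ln : (l <= n)%N.

Lemma sum_candidate_loss :
  (\sum_(1 <= u < n.+1) candidate_loss n u p l = candidates p l n)%N.
Proof.
rewrite exchange_big_nat /=.
by apply: eq_big_nat => d dn; rewrite sum_nat_bool_pred1//; lia.
Qed.

(** Exactly one u, the parent, masks a given unmasked candidate. The gain C - B and the loss 2 B
    combine to C - 3 B. *)
Lemma sum_masked_gain :
  (\sum_(1 <= u < n.+1) masked_gain n u p l + maskeds p l n =
   candidates p l n)%N.
Proof.
rewrite exchange_big_nat /= -big_split /=.
apply: eq_big_nat => d dn; rewrite sum_nat_bool_pred1; last first.
  by have := rp (i := d); lia.
by rewrite /masked; case: candidate => //=; case: has.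
Qed.

(** The two harmful choices, d and its witness, are distinct because d <= l < [mask n p l d]. *)
Lemma sum_masked_loss :
  (\sum_(1 <= u < n.+1) masked_loss n u p l = (maskeds p l n).*2)%N.
Proof.
rewrite exchange_big_nat /= -addnn -big_split /=.
apply: eq_big_nat => d dn.
have [md|_] := boolP (masked p l n d); last by rewrite big1.
have [wn _] := maskP md.
rewrite -{1}(@sum_nat_bool_pred1 1 n.+1 d true); last lia.
rewrite -{1}(@sum_nat_bool_pred1 1 n.+1 (mask n p l d) true); last lia.
rewrite -big_split /=; apply: eq_bigr => u _.
by have [->|] := eqVneq u d => //=; case: eqP => // e; lia.
Qed.

End StepSums.

Lemma maskeds_start p l : maskeds p l l = 0%N.
Proof.
by rewrite /maskeds big1// => d _; rewrite /masked /index_iota subnn andbF.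
Qed.

Lemma candidates_start p l : candidates p l l = lones p l.
Proof.
by apply: eq_bigr => d _; rewrite /candidate /lone; case: leafb; rewrite ?andbT.
Qed.

(** * Camouflaging vertices *)

Lemma child_ext p q m n : (n <= m)%N ->
  (forall i, (2 <= i <= m)%N -> p i = q i) -> child p n = child q n.
Proof.
move=> nm pq; apply/funext => u; apply/funext => v; rewrite /child.
by case: (boolP (2 <= v <= n)%N) => //= vn; rewrite pq//; lia.
Qed.

Lemma camouflaging_ext p q l v :
  (forall i, (2 <= i <= l.*2)%N -> p i = q i) ->
  camouflaging p l v = camouflaging q l v.
Proof.
move=> pq; have ll : (l <= l.*2)%N by lia.
rewrite /camouflaging /singleton /leaf /descendant.
rewrite (child_ext ll pq) (child_ext (leqnn _) pq).
apply/propext; split=> -[d [w [[dv [dl leafd desc]] wv leafw leafd']]];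
  exists d, w; split=> //; split=> //; split=> // y.
  by rewrite -pq; [exact: desc|lia].
by rewrite pq; [exact: desc|lia].
Qed.

Lemma camouflaging_count_ext p q l :
  (forall i, (2 <= i <= l.*2)%N -> p i = q i) ->
  camouflaging_count p l = camouflaging_count q l.
Proof. by move=> pq; apply: eq_bigr => v _;
  rewrite (camouflaging_ext _ pq). Qed.

Lemma leafb_leaf p n v : (1 <= v <= n)%N -> leafb p n v -> leaf p n v.
Proof.
move=> vn /leafbP h; split=> // c; rewrite negb_and.
by case: (boolP (2 <= c <= n)%N) => //= cn; apply: h.
Qed.

(** A chain of children from [p d] starts with d by uniqueness and ends there because d is a
    leaf. *)
Lemma lone_singleton p n d : (2 <= d <= n)%N -> lone p n d -> singleton p n d.
Proof.
move=> dn /loneP[leafd uniqd]; have [d1 noc] : leaf p n d.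
  by apply: leafb_leaf => //; lia.
split=> // w; split=> [[[|c s]]|->].
- by rewrite /= andbT => /andP[wn /eqP]; apply: uniqd.
- rewrite rcons_cons /= => /andP[/andP[cn /eqP pc]].
  rewrite (uniqd _ cn pc); case: s => [|e s] /= /andP[+ _].
    by rewrite (negbTE (noc w)).
  by rewrite (negbTE (noc e)).
- by exists [::]; rewrite /= /child dn eqxx.
Qed.

Lemma masked_camouflaging p l d : (2 <= d <= l)%N ->
  masked p l l.*2 d -> camouflaging p l (p d).
Proof.
move=> dl /andP[/andP[loned leafd] /hasP[w]].
rewrite mem_index_iota => wl /andP[/eqP pw leafw].
exists d, w; split.
- by split; [rewrite /child dl eqxx|exact: lone_singleton].
- by split=> //; rewrite /child pw eqxx andbT; lia.
- by apply: leafb_leaf => //; lia.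
- by apply: leafb_leaf => //; lia.
Qed.

(** Masked singletons are sent to their parents, which are camouflaging; this is injective since
    singletons have no siblings. *)
Lemma maskeds_le_count p l : recursive l.*2 p ->
  (maskeds p l l.*2 <= camouflaging_count p l)%N.
Proof.
move=> rp; pose b v d := masked p l l.*2 d && (v == p d).
have -> : maskeds p l l.*2 =
    (\sum_(1 <= v < l.+1) \sum_(2 <= d < l.+1) b v d)%N.
  rewrite exchange_big_nat; apply: eq_big_nat => d dl;
    rewrite sum_nat_bool_pred1//.
  by have := rp d; lia.
rewrite /camouflaging_count big_nat [leqRHS]big_nat; apply: leq_sum => v _.
case: asboolP => [_|ncam].
  apply: (@lone_sibling_le1 p l _ v) => d _ /andP[/andP[/andP[-> _] _] /eqP ->].
  by [].
rewrite leqn0 big_nat big1// => d dl; rewrite /b; apply/eqP; rewrite eqb0.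
apply/negP => /andP[md /eqP vd]; apply: ncam; rewrite vd.
exact: masked_camouflaging.
Qed.

(** * Exponential moments over all recursive trees *)

Section Mean.
Variable R : realType.
Implicit Types (F : (nat -> nat) -> R) (x : R).

(* [mean k F] is the average of F over the k! recursive trees on k + 1
   vertices. *)
Fixpoint mean (k : nat) (F : (nat -> nat) -> R) : R :=
  if k is j.+1 then
    mean j (fun p => j.+1%:R^-1 * \sum_(1 <= u < j.+2) F (attach p j.+2 u))
  else F (fun=> 0%N).

Lemma ler_mean k F F' :
  (forall p, recursive k.+1 p -> F p <= F' p) -> mean k F <= mean k F'.
Proof.
elim: k F F' => [|k IHk] F F' FF' /=; first by apply: FF' => i; lia.
apply: IHk => p rp; rewrite ler_pM2l ?invr_gt0 ?ltr0n//.
by apply: ler_sum_nat => u un; apply: FF'; apply: recursive_step.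
Qed.

Lemma eq_mean k F F' :
  (forall p, recursive k.+1 p -> F p = F' p) -> mean k F = mean k F'.
Proof.
by move=> FF'; apply/eqP; rewrite eq_le !ler_mean// => p /FF' ->.
Qed.

Lemma meanZ k c F : mean k (fun p => c * F p) = c * mean k F.
Proof.
elim: k F => //= k IHk F; rewrite -IHk; congr mean.
by apply/funext => p; rewrite -mulr_sumr mulrCA.
Qed.

Lemma meanD k F F' : mean k (fun p => F p + F' p) = mean k F + mean k F'.
Proof.
elim: k F F' => //= k IHk F F'; rewrite -IHk; congr mean.
by apply/funext => p; rewrite big_split mulrDr.
Qed.

Lemma mean_cst k c : mean k (fun=> c) = c.
Proof.
elim: k => //= k IHk; rewrite -[RHS]IHk; congr mean; apply/funext => p.
by rewrite sumr_const_nat subn1 -(mulr_natl c) mulrA mulVf ?mul1r// pnatr_eq0.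
Qed.

Lemma mean_sum k m n (F : nat -> (nat -> nat) -> R) :
  \sum_(m <= v < n) mean k (F v) = mean k (fun p => \sum_(m <= v < n) F v p).
Proof.
rewrite /index_iota; elim: (iota m _) => [|v s IHs].
  by rewrite big_nil -[LHS](mean_cst k); congr mean; apply/funext => p;
    rewrite big_nil.
rewrite big_cons IHs -meanD; congr mean; apply/funext => p; by rewrite big_cons.
Qed.

(** * Exponential estimate for one attachment *)

Lemma expR_le_quadratic (y : R) : y <= 2^-1 -> expR y <= 1 + y + 2 * y ^+ 2.
Proof.
move=> y2; have : expR y * (1 - y) <= 1.
  rewrite -[leRHS](expRxMexpNx_1 y) ler_pM2l ?expR_gt0//.
  exact: (expR_ge1Dx (- y)).
rewrite -ler_pdivlMr; last lra.
move/le_trans; apply; rewrite ler_pdivrMr; last lra.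
(* Here [(1 + y + 2 y^2) (1 - y) = 1 + y^2 (1 - 2 y)]. *)
have : 0 <= y ^+ 2 * (1 - 2 * y) by rewrite mulr_ge0 ?sqr_ge0//; lra.
nra.
Qed.

(** Each exponential is expanded to second order, and the average is turned back into an exponential
    by 1 + s <= exp s. *)
Lemma average_expR_le n (z : nat -> R) x m : (0 < n)%N -> 0 <= x <= 2^-1 ->
  (forall u, (1 <= u <= n)%N -> `|z u| <= 1) ->
  n%:R * m <= \sum_(1 <= u < n.+1) z u ->
  n%:R^-1 * (\sum_(1 <= u < n.+1) expR (- (x * z u))) <=
  expR (- (x * m) + 2 * x ^+ 2).
Proof.
move=> n0 /andP[x0 x2] z1 zm; rewrite ler_pdivrMl ?ltr0n//.
apply: (@le_trans _ _ (\sum_(1 <= u < n.+1) (1 + 2 * x ^+ 2 - x * z u))).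
  apply: ler_sum_nat => u un; have := z1 u un;
    rewrite ler_norml => /andP[z1l z1r].
  apply: (le_trans (expR_le_quadratic _)); first nra.
  have : (x * z u) ^+ 2 <= x ^+ 2 by rewrite exprMn ler_piMr ?sqr_ge0//; nra.
  rewrite sqrrN; lra.
rewrite sumrB sumr_const_nat subn1 -mulr_sumr -(mulr_natl (1 + _)).
apply: (@le_trans _ _ (n%:R * (1 + (- (x * m) + 2 * x ^+ 2)))).
  by have := ler_wpM2l x0 zm; lra.
by rewrite ler_wpM2l ?ler0n// expR_ge1Dx.
Qed.

(** [Phi0] and [Phi] are the statistic before and after the attachment, [z] bounds its increment
    from below, and [Psi] its conditional mean. Lower bounds suffice as x >= 0. *)
Lemma mean_expR_step k x (Phi Psi Phi0 : (nat -> nat) -> R)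
    (z : (nat -> nat) -> nat -> R) : 0 <= x <= 2^-1 ->
  (forall p u, recursive k.+1 p -> (1 <= u <= k.+1)%N ->
     `|z p u| <= 1 /\ Phi0 p + z p u <= Phi (attach p k.+2 u)) ->
  (forall p, recursive k.+1 p ->
     k.+1%:R * (Psi p - Phi0 p) <= \sum_(1 <= u < k.+2) z p u) ->
  mean k.+1 (fun p => expR (- (x * Phi p))) <=
  expR (2 * x ^+ 2) * mean k (fun p => expR (- (x * Psi p))).
Proof.
move=> x01 zP zm; rewrite -meanZ /=; apply: ler_mean => p rp /=.
have z1 u : (1 <= u <= k.+1)%N -> `|z p u| <= 1.
  by move=> uk; have [] := zP p u rp uk.
have := average_expR_le (ltn0Sn k) x01 z1 (zm p rp).
rewrite -(ler_pM2l (expR_gt0 (- (x * Phi0 p)))) => h; rewrite -expRD.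
apply: le_trans (le_trans h _); last by rewrite -expRD ler_expR; lra.
rewrite mulrCA ler_pM2l ?invr_gt0 ?ltr0n// mulr_sumr.
apply: ler_sum_nat => u uk; have [_ PhiP] := zP p u rp uk.
rewrite -expRD ler_expR; case/andP: x01 => x0 _.
by have := ler_wpM2l x0 PhiP; lra.
Qed.

(* k.+2 / 2 is the mean of leaves p k.+2, and k.+2 / 6 that of lones p k.+2 for
   k > 0. *)
Lemma mean_expR_lones k (a b x : R) : 0 <= x <= 2^-1 -> 0 <= a -> 0 <= b ->
  a + b <= 1 ->
  mean k.+1 (fun p =>
    expR (- (x * (a * (lones p k.+2)%:R + b * (leaves p k.+2)%:R)))) <=
  expR (2 * x ^+ 2 * k%:R - x * (a * (k.+2%:R / 6) + b * (k.+2%:R / 2))).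
Proof.
move=> x01; elim: k a b => [|k IHk] a b a0 b0 ab1.
  (* T_2 has one leaf and one singleton, against the claimed 2/2 and 2/6. *)
  rewrite /= invr1 mul1r big_nat1.
  have -> : leaves (attach (fun=> 0%N) 2 1) 2 = 1%N.
    by rewrite /leaves /leafb /attach /index_iota unlock.
  have -> : lones (attach (fun=> 0%N) 2 1) 2 = 1%N.
    by rewrite /lones /lone /leafb /attach /index_iota unlock.
  rewrite ler_expR; case/andP: x01 => x0 _.
  have : 0 <= x * a by rewrite mulr_ge0.
  lra.
pose n := k.+2; rewrite -/n.
have n0 : (0 : R) < n%:R by rewrite ltr0n.
have n2 : (2 : R) <= n%:R by rewrite ler_nat.
(* Coefficients of S_n and L_n in the conditional mean of a S_{n+1} + b L_{n+1}; its constant term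
   is b. *)
pose a' := a * ((n%:R - 2) / n%:R);
  pose b' := a / n%:R + b * ((n%:R - 1) / n%:R).
have step := @mean_expR_step k.+1 x
  (fun p => a * (lones p n.+1)%:R + b * (leaves p n.+1)%:R)
  (fun p => a' * (lones p n)%:R + b' * (leaves p n)%:R + b)
  (fun p => a * (lones p n)%:R + b * (leaves p n)%:R)
  (fun p u => a * ((leafb p n u)%:R - (lone_loss n u p)%:R) +
              b * (1 - (leafb p n u)%:R)) x01.
apply: le_trans (step _ _) _.
- move=> p u rp un; split.
    have := lone_loss_le1 n u p; rewrite -(ler_nat R).
    have : (0 : R) <= (lone_loss n u p)%:R by rewrite ler0n.
    by case: (leafb p n u) => /=; rewrite ler_norml => l0 l1; apply/andP;
      split; nra.
  have := lones_step rp un; have := leaves_step rp un; rewrite -/n.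
  move/(congr1 (fun i => i%:R : R)); rewrite !natrD => eL.
  move/(congr1 (fun i => i%:R : R)); rewrite !natrD => eS.
  have -> : (lones (attach p n.+1 u) n.+1)%:R =
    (lones p n)%:R + (leafb p n u)%:R - (lone_loss n u p)%:R :> R by lra.
  have -> : (leaves (attach p n.+1 u) n.+1)%:R =
    (leaves p n)%:R + 1 - (leafb p n u)%:R :> R by lra.
  lra.
- move=> p rp;
    rewrite -/n big_split /= -!mulr_sumr !sumrB sumr_const_nat subn1 /=.
  rewrite -!natr_sum (sum_lone_loss rp) -/(leaves p n) -/n.
  rewrite -addnn natrD /a' /b' le_eqVlt; apply/orP; left; apply/eqP.
  by field; rewrite lt0r_neq0.
have a'0 : 0 <= a' by rewrite /a' mulr_ge0// divr_ge0//; lra.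
have b'0 : 0 <= b'.
  by apply: addr_ge0; [exact: divr_ge0|apply: mulr_ge0 => //; apply: divr_ge0;
    lra].
have a'b' : a' + b' <= 1.
  have -> : a' + b' = (a + b) * ((n%:R - 1) / n%:R).
    by rewrite /a' /b'; field; rewrite lt0r_neq0.
  have : (n%:R - 1) / n%:R <= (1 : R) by rewrite ler_pdivrMr//; lra.
  have : 0 <= (n%:R - 1) / n%:R :> R by rewrite divr_ge0//; lra.
  nra.
have -> : (fun p =>
    expR (- (x * (a' * (lones p n)%:R + b' * (leaves p n)%:R + b)))) =
  (fun p => expR (- (x * b)) *
            expR (- (x * (a' * (lones p n)%:R + b' * (leaves p n)%:R)))).
  by apply/funext => p; rewrite -expRD; congr expR; lra.
rewrite meanZ.
apply: (@le_trans _ _ (expR (2 * x ^+ 2) * (expR (- (x * b)) *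
  expR (2 * x ^+ 2 * k%:R - x * (a' * (n%:R / 6) + b' * (n%:R / 2)))))).
  by rewrite !ler_pM2l ?expR_gt0//; apply: IHk.
(* Equality, because n/6 and n/2 solve the two recurrences exactly. *)
rewrite -!expRD ler_expR le_eqVlt; apply/orP; left; apply/eqP.
rewrite /a' /b' -![_.+1%:R]natr1 -/n.
have -> : k%:R = n%:R - 2 :> R by rewrite /n -!natr1; lra.
by field; rewrite lt0r_neq0//; lra.
Qed.

(* In the limit, the mean of maskeds p l (l + m) is
   l tau (1 - tau ^ 2) / 12 with tau = l / (l + m), which stays above the
   simpler m / 60. *)
Lemma mean_expR_maskeds j m (a b x : R) : 0 <= x <= 2^-1 -> 0 <= a -> 0 <= b ->
  a + b <= 1 -> (m <= j.+2)%N ->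
  mean (j.+1 + m) (fun p => expR (- (x * (a * (maskeds p j.+2 (j.+2 + m))%:R +
    b * (candidates p j.+2 (j.+2 + m))%:R)))) <=
  expR (2 * x ^+ 2 * (j + m)%:R -
    x * (a * (m%:R / 60) + b * (j.+2%:R * j.+1%:R / (6 * (j.+1 + m)%:R)))).
Proof.
move=> x01; elim: m a b => [|m IHm] a b a0 b0 ab1 ml.
  rewrite !addn0 mul0r mulr0 add0r.
  (* With l = j + 2 and n = l + m, the value l (l - 1) / (6 (n - 1)) follows the recurrence for C
     and starts at l/6. *)
  have -> : j.+2%:R * j.+1%:R / (6 * j.+1%:R) = j.+2%:R / 6 :> R.
    have : j.+1%:R != 0 :> R by rewrite pnatr_eq0.
    by move: (j.+1%:R) (j.+2%:R) => y z y0; field.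
  (* B_l = 0 and C_l = S_l, so the bound for singletons applies with coefficients b and 0. *)
  have b1 : b + 0 <= 1 by lra.
  apply: le_trans (le_trans (mean_expR_lones j x01 b0 (lexx 0) b1) _).
    apply: ler_mean => p _; rewrite maskeds_start candidates_start.
    by rewrite mulr0 add0r mul0r addr0.
  by rewrite mul0r addr0.
pose l := j.+2; pose n := (l + m)%N; pose k := (j.+1 + m)%N.
rewrite -/l !addnS -/k -/n.
have ln : (l <= n)%N by apply: leq_addr.
have l2 : (2 : R) <= l%:R by rewrite ler_nat.
have nE : n%:R = l%:R + m%:R :> R by rewrite natrD.
have m0 : (0 : R) <= m%:R by [].
have ml' : m%:R <= l%:R - 1 :> R by rewrite lerBrDr natr1 ler_nat.
have n0 : (0 : R) < n%:R by lra.
have kE : k%:R = n%:R - 1 :> R by rewrite -[n]/(k.+1) -natr1; lra.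
have jE : j.+1%:R = l%:R - 1 :> R by rewrite /l -natr1; lra.
(* Truncation keeps [a'] nonnegative: c = 0 instead of -1 for n = 2. This only occurs at n = l,
   where B_n = 0. *)
pose c := (n - 3)%N%:R : R.
have c0 : 0 <= c by [].
have c3 : n%:R - 3 <= c by rewrite lerBlDr -natrD ler_nat; clear; lia.
have c1 : c + 1 <= n%:R by rewrite natr1 ler_nat; clear; lia.
pose a' := a * (c / n%:R); pose b' := a / n%:R + b * ((n%:R - 1) / n%:R).
have step := @mean_expR_step k x
  (fun p => a * (maskeds p l n.+1)%:R + b * (candidates p l n.+1)%:R)
  (fun p => a' * (maskeds p l n)%:R + b' * (candidates p l n)%:R)
  (fun p => a * (maskeds p l n)%:R + b * (candidates p l n)%:R)
  (fun p u => a * ((masked_gain n u p l)%:R - (masked_loss n u p l)%:R) -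
              b * (candidate_loss n u p l)%:R) x01.
apply: le_trans (step _ _) _ => {step}.
- move=> p u rp un; split.
    have := masked_gain_le1 n u p l; have := masked_loss_le1 n u p l.
    have := candidate_loss_le1 n u p l; rewrite -!(ler_nat R).
    have : (0 : R) <= (masked_gain n u p l)%:R by [].
    have : (0 : R) <= (masked_loss n u p l)%:R by [].
    have : (0 : R) <= (candidate_loss n u p l)%:R by [].
    by move=> *; rewrite ler_norml; apply/andP; split; nra.
  have := candidates_step p un ln; move/(congr1 (fun i => i%:R : R)).
  have := maskeds_step rp un ln; rewrite -(ler_nat R) !natrD.
  rewrite -/n -/l => /(ler_wpM2l a0) eB eC.
  have -> : (candidates (attach p n.+1 u) l n.+1)%:R =
    (candidates p l n)%:R - (candidate_loss n u p l)%:R :> R by lra.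
  lra.
- move=> p rp; rewrite sumrB -!mulr_sumr sumrB -!natr_sum.
  rewrite (sum_candidate_loss p ln) (sum_masked_loss p ln).
  have := sum_masked_gain rp ln; move/(congr1 (fun i => i%:R : R)).
  rewrite natrD => gainE.
  have -> : (\sum_(1 <= u < k.+2) masked_gain n u p l)%:R =
    (candidates p l n)%:R - (maskeds p l n)%:R :> R by lra.
  have -> : k.+1 = n by [].
  rewrite -addnn natrD.
  have -> : n%:R * (a' * (maskeds p l n)%:R + b' * (candidates p l n)%:R -
      (a * (maskeds p l n)%:R + b * (candidates p l n)%:R)) =
    a * (c * (maskeds p l n)%:R) - n%:R * a * (maskeds p l n)%:R +
      (a - b) * (candidates p l n)%:R.
    by rewrite /a' /b'; field; rewrite lt0r_neq0.
  suff -> : c * (maskeds p l n)%:R = (n%:R - 3) * (maskeds p l n)%:R by lra.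
  have [n3|n3] := leqP 3 n; first by rewrite /c natrB.
  have -> : n = l by move: n3; rewrite /n /l; clear; lia.
  by rewrite maskeds_start !mulr0.
have a'0 : 0 <= a' by rewrite /a' mulr_ge0// divr_ge0.
have b'0 : 0 <= b'.
  by apply: addr_ge0; [exact: divr_ge0|apply: mulr_ge0 => //; apply: divr_ge0;
    lra].
have a'b' : a' + b' <= 1.
  have -> : a' + b' = (a * (c + 1) + b * (n%:R - 1)) / n%:R.
    by rewrite /a' /b'; field; rewrite lt0r_neq0.
  by rewrite ler_pdivrMr//; nra.
apply: (@le_trans _ _ (expR (2 * x ^+ 2) *
  expR (2 * x ^+ 2 * (j + m)%:R -
    x * (a' * (m%:R / 60) + b' * (l%:R * j.+1%:R / (6 * k%:R)))))).
  by rewrite ler_pM2l ?expR_gt0//; apply: IHm => //; exact: ltnW.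
have jmE : (j + m)%:R = n%:R - 2 :> R by rewrite /n /l !natrD -!natr1; ring.
rewrite -expRD ler_expR -[(j + m).+1%:R]natr1 -[m.+1%:R]natr1 -[k.+1%:R]natr1.
have -> : (j + m)%:R + 1 = n%:R - 1 :> R by rewrite jmE; ring.
rewrite jmE jE ?kE.
have n1 : 0 < n%:R - 1 :> R by lra.
suff : a * ((m%:R + 1) / 60) + b * (l%:R * (l%:R - 1) / (6 * (n%:R - 1 + 1))) <=
    a' * (m%:R / 60) + b' * (l%:R * (l%:R - 1) / (6 * (n%:R - 1))).
  by case/andP: x01 => x0 _ h; have := ler_wpM2l x0 h; lra.
(* The terms in b agree on both sides; only those in a remain. *)
have -> : a' * (m%:R / 60) + b' * (l%:R * (l%:R - 1) / (6 * (n%:R - 1))) =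
  a * ((c * m%:R * (n%:R - 1) + 10 * l%:R * (l%:R - 1)) /
       (60 * n%:R * (n%:R - 1))) +
  b * (l%:R * (l%:R - 1) / (6 * (n%:R - 1 + 1))).
  by rewrite /a' /b'; field; rewrite !lt0r_neq0//; lra.
rewrite lerD2r; apply: ler_wpM2l => //.
rewrite ler_pdivlMr ?mulr_gt0//.
have : 0 <= (c - (n%:R - 3)) * (m%:R * (n%:R - 1)).
  by rewrite mulr_ge0 ?subr_ge0// mulr_ge0//; lra.
(* What remains when c = n - 3. As m <= l - 1, the factors are at most 2 (l - 1) and 5 l, whence 60
   = 6 * 10. *)
have : (l%:R + m%:R - 1) * (l%:R + 4 * m%:R) <=
    10 * l%:R * (l%:R - 1) :> R by nra.
rewrite nE; nra.
Qed.

(** The case m = l, a = 1, b = 0: the 2 l - 2 steps down to T_2 cost 2 x^2 each. *)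
Lemma mean_expR_maskeds_end l x : (2 <= l)%N -> 0 <= x <= 2^-1 ->
  mean l.*2.-1 (fun p => expR (- (x * (maskeds p l l.*2)%:R))) <=
  expR (4 * x ^+ 2 * l%:R - x * (l%:R / 60)).
Proof.
case: l => [//|[//|j]] _ x01.
have := mean_expR_maskeds x01 ler01 (lexx 0) _ (leqnn j.+2);
  rewrite addr0 => /(_ (lexx 1)).
have -> : (j.+1 + j.+2 = j.+2.*2.-1)%N by rewrite -addnn addSn.
rewrite addnn => h; apply: le_trans (le_trans h _).
  by apply: ler_mean => p _; rewrite mul1r mul0r addr0.
rewrite ler_expR mul1r mul0r addr0 lerD2r -mulrA -[4 * _ * _]mulrA.
have -> : 4 = 2 * 2 :> R by lra.
rewrite -mulrA ler_wpM2l// mulrCA ler_wpM2l ?sqr_ge0// -natrM ler_nat; lia.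
Qed.

End Mean.

(** * The law of the parents *)

Section Law.
Variables (R : realType) (d : measure_display) (T : measurableType d).
Variables (P : probability T R) (n : nat) (parent : nat -> {RV P >-> nat}).

Definition cylinder (k : nat) (q : nat -> nat) : set T :=
  \bigcap_(i in [set i | (2 <= i <= k.+1)%N]) (parent i @^-1` [set q i]).

Lemma measurable_parent i (A : set nat) : measurable (parent i @^-1` A).
Proof. by rewrite -[X in measurable X]setTI; exact: measurable_funP. Qed.

Lemma measurable_cylinder k q : measurable (cylinder k q).
Proof. by apply: bigcap_measurableType => i _; exact: measurable_parent. Qed.

(** Finitely many parents matter, so the event is a countable union of cylinders, indexed by
    sequences of values. *)
Lemma measurable_parents (b : (nat -> nat) -> Prop) m :
  (forall p q, (forall i, (2 <= i <= m)%N -> p i = q i) -> b p -> b q) ->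
  measurable [set x | b (fun i => parent i x)].
Proof.
move=> bP.
rewrite (_ : [set x | _] = \bigcup_(s : seq nat)
    (if `[< b (nth 0%N s) >] then cylinder m.-1 (nth 0%N s) else set0)).
  apply: countable_bigcupT_measurable => [|s]; first exact: countableP.
  by case: asboolP => _; [exact: measurable_cylinder|exact: measurable0].
apply/seteqP; split=> [x /= bx|x [s _]]; last first.
  case: asboolP => // bs cx; apply: bP bs => i im.
  by rewrite (cx i)//=; lia.
pose s := mkseq (fun i => parent i x) m.+1.
have sE i : (2 <= i <= m)%N -> parent i x = nth 0%N s i.
  by move=> im; rewrite nth_mkseq//; lia.
exists s => //; case: asboolP => [_ i /= im|]; last by case; exact: bP bx.
by rewrite sE//; lia.
Qed.

Hypothesis rrt : uniform_random_recursive_tree n parent.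

Lemma probability_cylinder k q : (k < n)%N -> recursive k.+1 q ->
  P (cylinder k q) = (k`!%:R^-1)%:E.
Proof.
move=> kn rq; pose J := [fset i in iota 2 k]%fset.
have JE i : (i \in J) = (2 <= i <= k.+1)%N by rewrite !inE mem_iota; lia.
have -> : cylinder k q = \bigcap_(i in [set` J]) (parent i @^-1` [set q i]).
  rewrite /cylinder; congr (bigcap _ _).
  by apply/seteqP; split=> i /=; rewrite JE.
have [indep unif] := rrt.
rewrite indep//; last by move=> i /=; rewrite JE; lia.
rewrite (perm_big (iota 2 k)); last first.
  by apply: uniq_perm; rewrite ?fset_uniq ?iota_uniq// => i;
    rewrite JE mem_iota; lia.
rewrite big_seq (eq_bigr (fun i => ((i.-1)%:R^-1 : R)%:E)); last first.
  by move=> i; rewrite mem_iota => ik; rewrite unif//; [lia|have := rq i; lia].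
rewrite -big_seq prodEFin; congr EFin; rewrite prodfV -natr_prod;
  congr (_%:R^-1).
by rewrite fact_prod /index_iota subSS subn0 -[2%N]/(1 + 1)%N iotaDl big_map.
Qed.

(** The k + 1 admissible parents of vertex k + 2 have probability 1 / (k + 1) each, so all other
    values form a null event. *)
Lemma probability_cylinder_split k q A : (k.+1 < n)%N -> measurable A ->
  P (A `&` cylinder k q) =
  (\sum_(1 <= u < k.+2) P (A `&` cylinder k.+1 (attach q k.+2 u)))%E.
Proof.
move=> kn mA; have [_ unif] := rrt.
pose B i := parent k.+2 @^-1` [set i.+1].
have mB i : measurable (B i) by exact: measurable_parent.
have tB : trivIset setT B.
  by move=> i j _ _ [x []]; rewrite /B /= => -> [].
pose U := \big[setU/set0]_(i < k.+1) B i.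
have mU : measurable U by exact: bigsetU_measurable.
have PU : P (~` U) = 0%E.
  rewrite probability_setC// measure_bigsetU//.
  rewrite (eq_bigr (fun=> (k.+1%:R^-1 : R)%:E)); last first.
    by move=> i _; apply: unif; [lia|have := ltn_ord i; lia].
  rewrite sumEFin sumr_const card_ord -(mulr_natl k.+1%:R^-1) divff ?pnatr_eq0//.
  by rewrite -EFinB subrr.
pose C i := A `&` cylinder k.+1 (attach q k.+2 i.+1).
have CE i : C i = (A `&` cylinder k q) `&` B i.
  rewrite /C -setIA; congr (_ `&` _); apply/seteqP; split=> x.
    move=> cx; split; last by have := cx k.+2; rewrite /attach /= eqxx; apply;
      lia.
    move=> j /= jk; have := cx j; rewrite /attach /= ltn_eqF; last lia.
    by apply; lia.
  move=> [cx Bx] j /= jk; rewrite /attach; case: eqP => [->//|ne].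
  by apply: cx => /=; lia.
have mC i : measurable (C i).
  by apply: measurableI => //; exact: measurable_cylinder.
have mAc : measurable (A `&` cylinder k q).
  by apply: measurableI => //; exact: measurable_cylinder.
rewrite big_add1 big_mkord -(@measure_bigsetU _ _ _ P C)//; last first.
  move=> i j _ _ [x []]; rewrite !CE => -[_ Bi] [_ Bj].
  by apply: tB => //; exists x.
rewrite (_ : \big[setU/set0]_(i < k.+1) C i = (A `&` cylinder k q) `&` U);
  last first.
  by rewrite /U big_distrr /=; apply: eq_bigr => i _; rewrite CE.
rewrite (measureDI P mAc mU) [X in (X + _)%E = _](_ : _ = 0%E) ?add0e//.
apply: subset_measure0 PU => [||x []//]; first exact: measurableD.
exact: measurableC.
Qed.

Lemma probability_parents (b : (nat -> nat) -> Prop) : (0 < n)%N ->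
  (forall p q, (forall i, (2 <= i <= n)%N -> p i = q i) -> b p -> b q) ->
  P [set x | b (fun i => parent i x)] =
  (mean n.-1 (fun q => `[< b q >]%:R : R))%:E.
Proof.
move=> n0 bP; set A := [set x | _].
have mA : measurable A by exact: measurable_parents bP.
(* By induction on k: k! P(A and [cylinder k q]) is the probability of A given that T_{k+1} is q. At
   k = n - 1 it is 0 or 1. *)
have PA k : (k < n)%N -> fine (P A) =
    mean k (fun q => k`!%:R * fine (P (A `&` cylinder k q))).
  elim: k => [_|k IHk kn].
    rewrite /= fact0 mul1r (_ : cylinder 0 _ = setT) ?setIT//.
    by rewrite -subTset => x _ i /=; lia.
  rewrite IHk; last by lia.
  apply: eq_mean => q rq; rewrite probability_cylinder_split//.
  rewrite -mulr_sumr mulrA factS natrM mulrA mulVf ?pnatr_eq0// mul1r.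
  congr (_ * _); rewrite -sum_fine// => u _; rewrite fin_num_measure//.
  by apply: measurableI => //; exact: measurable_cylinder.
rewrite -[LHS]fineK ?fin_num_measure// (PA n.-1); last by lia.
congr EFin; apply: eq_mean => q rq; case: asboolP => bq.
  rewrite (_ : A `&` _ = cylinder n.-1 q).
    by rewrite probability_cylinder ?mulfV ?pnatr_eq0 -?lt0n ?fact_gt0//; lia.
  apply/setIidPr => x cx; apply: bP bq => i im.
  by rewrite (cx i)//=; lia.
rewrite (_ : A `&` _ = set0) ?measure0 ?mulr0//.
rewrite -subset0 => x [bx cx]; apply: bq; apply: bP bx => i im.
by rewrite (cx i)//=; lia.
Qed.

End Law.

(** * The two bounds *)

Section Camouflage.
Variables (R : realType) (l : nat).
Hypothesis l_ge2 : (2 <= l)%N.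
Implicit Types t x : R.

Lemma recursive_double p : recursive l.*2.-1.+1 p -> recursive l.*2 p.
Proof. by rewrite prednK//; lia. Qed.

Lemma mean_camouflaging_count_ge :
  l%:R / 384 <= mean l.*2.-1 (fun p => (camouflaging_count p l)%:R) :> R.
Proof.
pose m : R := mean l.*2.-1 (fun p => (maskeds p l l.*2)%:R).
apply: (@le_trans _ _ m); last first.
  by apply: ler_mean => p /recursive_double rp;
    rewrite ler_nat maskeds_le_count.
pose x : R := (480 * l%:R)^-1.
have l2 : 2 <= l%:R :> R by rewrite ler_nat.
have l0 : 0 < l%:R :> R by lra.
have xl : x * l%:R = 480^-1 by rewrite /x; field; rewrite lt0r_neq0.
have x0 : 0 < x by rewrite invr_gt0; lra.
have xl2 : 0 <= x * (l%:R - 2) by rewrite mulr_ge0 ?subr_ge0// ltW.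
clearbody x.
have x01 : 0 <= x <= 2^-1 by rewrite (ltW x0) /=; lra.
have jensen : 1 - x * m <=
    mean l.*2.-1 (fun p => expR (- (x * (maskeds p l l.*2)%:R))).
  rewrite -[1 in leLHS](@mean_cst R l.*2.-1) -mulNr -meanZ -meanD.
  by apply: ler_mean => p _; rewrite mulNr; exact: expR_ge1Dx.
have := le_trans jensen (mean_expR_maskeds_end l_ge2 x01).
have -> : 4 * x ^+ 2 * l%:R - x * (l%:R / 60) =
    4 * x * (x * l%:R) - (x * l%:R) / 60 by ring.
rewrite xl => xm.
(* As l >= 2, x <= 1/960, so the first term is at most a quarter of the second. *)
have yle : 4 * x * 480^-1 - 480^-1 / 60 <= - (480 * 80)^-1 :> R by lra.
have y2 : - (480 * 80)^-1 <= 2^-1 :> R by lra.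
have := le_trans xm (le_trans _ (expR_le_quadratic y2)).
rewrite ler_expR => /(_ yle) xm'.
(* The gap between 80 and 384 absorbs the quadratic term; dividing by x gives l/384. *)
have : (480 * 384)^-1 <= x * m by lra.
rewrite -(ler_pM2r l0) mulrAC xl; lra.
Qed.

Lemma mean_camouflaging_count_tail t : 0 <= t ->
  mean l.*2.-1 (fun p =>
    `[< (camouflaging_count p l)%:R <= l%:R / 384 - t >]%:R : R) <=
  expR (- (t ^+ 2 / (2 * l%:R))).
Proof.
move=> t0; have l2 : 2 <= l%:R :> R by rewrite ler_nat.
have l0 : 0 < l%:R :> R by lra.
(* For t > l/384 the event is empty, since the count is nonnegative. *)
have [tl|tl] := leP t (l%:R / 384); last first.
  apply: (@le_trans _ _ 0); last exact: expR_ge0.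
  rewrite -(@mean_cst R l.*2.-1 0); apply: ler_mean => p _.
  case: asboolP => // h; have : (0 : R) <= (camouflaging_count p l)%:R by [].
  lra.
pose x := t / l%:R.
have xl : x * l%:R = t by rewrite divfK// lt0r_neq0.
have x0 : 0 <= x by rewrite divr_ge0// ltW.
have x01 : 0 <= x <= 2^-1 by rewrite x0 /= /x ler_pdivrMr//; lra.
have markov (c y : R) : y <= c -> 1 <= expR (x * c) * expR (- (x * y)).
  by move=> yc; rewrite -expRD -expR0 ler_expR -mulrBr mulr_ge0// subr_ge0.
apply: (@le_trans _ _ (mean l.*2.-1 (fun p => expR (x * (l%:R / 384 - t)) *
    expR (- (x * (maskeds p l l.*2)%:R))))).
  apply: ler_mean => p /recursive_double rp; case: asboolP => [h|_].
    by apply: markov; apply: le_trans h; rewrite ler_nat maskeds_le_count.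
  by rewrite mulr_ge0 ?expR_ge0.
rewrite meanZ.
apply: le_trans (ler_wpM2l (expR_ge0 _) (mean_expR_maskeds_end l_ge2 x01)) _.
rewrite -expRD ler_expR.
have -> : t ^+ 2 / (2 * l%:R) = x * t / 2.
  by rewrite /x; field; rewrite lt0r_neq0.
have -> : 4 * x ^+ 2 * l%:R - x * (l%:R / 60) = x * (4 * t - l%:R / 60).
  by rewrite -xl; ring.
(* As t <= l/384, the total exponent x (3 t + l/384 - l/60) is at most - x t / 2. *)
have : 0 <= x * (l%:R / 384 - t) by apply: mulr_ge0; [exact: x0|lra].
have : 0 <= x * t by rewrite mulr_ge0.
lra.
Qed.

End Camouflage.

(* For l = 1 both bounds fail: see camouflaging_count1. *)
Theorem theorem6 (R : realType) (d : measure_display) (T : measurableType d)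
    (P : probability T R) (l : nat) (parent : nat -> {RV P >-> nat})
    (l_ge2 : (2 <= l)%N)
    (rrt : uniform_random_recursive_tree l.*2 parent) :
  let G : T -> R := fun x => (camouflaging_count (fun i => parent i x) l)%:R in
  ((l%:R / 384%:R)%:E <= 'E_P[G])%E /\
  forall t : R, 0 <= t ->
    (P [set x | (G x <= l%:R / 384%:R - t)%R] <=
     (expR (- (t ^+ 2 / (2 * l%:R))))%:E)%E.
Proof.
have n0 : (0 < l.*2)%N by lia.
move=> G; split=> [|t t0]; last first.
  rewrite /G (probability_parents (b := fun p =>
    (camouflaging_count p l)%:R <= l%:R / 384%:R - t) rrt n0).
    by rewrite lee_fin; exact: mean_camouflaging_count_tail.
  by move=> p q pq; rewrite (camouflaging_count_ext pq).
pose A v : set T := [set x | camouflaging (fun i => parent i x) l v].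
have bP v p q : (forall i, (2 <= i <= l.*2)%N -> p i = q i) ->
  camouflaging p l v -> camouflaging q l v.
  by move=> /camouflaging_ext ->.
have mA v : measurable (A v) by apply: measurable_parents (bP v).
(* G is a finite sum of indicators, so its mean reduces to probabilities, which the law of the tree
   evaluates. *)
have -> : ('E_P[G] = \sum_(1 <= v < l.+1) P (A v))%E.
  rewrite unlock.
  under eq_integral do rewrite /G /camouflaging_count natr_sum -sumEFin.
  rewrite ge0_integral_sum//=; last first.
    move=> v; apply/measurable_EFinP.
    by rewrite (_ : (fun x => _) = \1_(A v))//; exact: measurable_indic.
  apply: eq_bigr => v _; rewrite -[A v in RHS]setIT -integral_indic//.
under eq_bigr do rewrite (probability_parents rrt n0 (@bP _)).
rewrite sumEFin mean_sum lee_fin (_ : (fun p => _) =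
  (fun p => (camouflaging_count p l)%:R)); last by apply/funext => p;
    rewrite natr_sum.
exact: mean_camouflaging_count_ge.
Qed.
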